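(* Let $\mathcal{B}$ be a simple, regular, $C^1$ composite Bézier curve in $\mathbb{R}^3$. Then the exterior angles of the PL curves (control polygons) generated by subdivision of $\mathcal{B}$ converge uniformly to $0$ at a rate of $O\!\left(\sqrt{1/2^i}\right)$: there exist a constant $C>0$ and an integer $i_0\ge 0$ such that for every $i\ge i_0$, every exterior angle $\alpha$ of the control polygon obtained after $i$ subdivisions satisfies $\alpha\le C\sqrt{\tfrac{1}{2^i}}$.
   Context: A Bézier curve of degree $n\ge 1$ with control points $p_0,\dots,p_n\in\mathbb{R}^3$ is $t\mapsto\sum_{j=0}^n\binom nj t^j(1-t)^{n-j}p_j$, $t\in[0,1]$; the PL curve through $p_0,\dots,p_n$ is its control polygon. A composite Bézier curve $\mathcal{B}:[0,1]\to\mathbb{R}^3$ is made of $m\ge1$ Bézier segments of common degree $n$ joined at common end points, the $s$-th segment (affinely reparametrized) occupying the parameter interval $[\frac{s-1}{m},\frac sm]$. Simple means non-self-intersecting (injective, except that $\mathcal{B}(0)=\mathcal{B}(1)$ is allowed, in which case the curve is closed); regular means the first derivative never vanishes; $C^1$ means continuously differentiable on $[0,1]$, with $\mathcal{B}'(0)=\mathcal{B}'(1)$ if the curve is closed. Subdivision is the de Casteljau algorithm with parameter $\frac12$: for a control polygon $(q_0,\dots,q_n)$ put $q_j^0=q_j$ and $q_j^l=\frac12(q_j^{l-1}+q_{j+1}^{l-1})$; one subdivision replaces it by the two polygons $(q_0^0,q_0^1,\dots,q_0^n)$ and $(q_0^n,q_1^{n-1},\dots,q_n^0)$. After $i$ iterations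 applied to every segment there are $K=m2^i$ sub-control polygons $P^1,\dots,P^K$, where $P^k$ is the control polygon of the part of $\mathcal{B}$ over $[\frac{k-1}K,\frac kK]$ and the last vertex of $P^k$ is the first vertex of $P^{k+1}$. Their union is the control polygon of $\mathcal{B}$ after $i$ subdivisions, a PL curve with vertices $p_0,\dots,p_{nK}$. The exterior angle of a PL curve at a vertex $p_j$ is the angle in $[0,\pi]$ between the vectors $p_j-p_{j-1}$ and $p_{j+1}-p_j$ (it is defined when both are nonzero). *)

(* Defs.v *)
From mathcomp Require Import all_boot all_order all_algebra.
From mathcomp Require Import all_classical all_reals all_analysis.
Import Order.TTheory GRing.Theory Num.Theory.
Import numFieldNormedType.Exports.

Set Implicit Arguments.
Unset Strict Implicit.
Unset Printing Implicit Defensive.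

Local Open Scope classical_set_scope.
Local Open Scope ring_scope.

Section Bezier.
Context {R : realType}.
Notation point := 'rV[R]_3.

Definition dot (u v : point) : R := \sum_i u ord0 i * v ord0 i.

(* The library norm on 'rV[R]_3 is the sup norm; it induces the same topology,
   but angles need the Euclidean one. *)
Definition enorm (u : point) : R := Num.sqrt (dot u u).

(* Meaningful only for u, v != 0. *)
Definition angle (u v : point) : R := acos (dot u v / (enorm u * enorm v)).

Definition bezier n (q : n.+1.-tuple point) (t : R) : point :=
  \sum_(j < n.+1) ('C(n, j)%:R * t ^+ j * (1 - t) ^+ (n - j)) *: tnth q j.

(* Segments are numbered from 0. Evaluating both formulas at a common parameter
   s.+1 / m forces consecutive segments to share their end point. The values of
   B outside [0, 1] are irrelevant. *)
Definition composite_bezier m n (P : m.-tuple (n.+1.-tuple point))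
    (B : R -> point) : Prop :=
  forall (s : 'I_m) (t : R), s%:R / m%:R <= t <= s.+1%:R / m%:R ->
    B t = bezier (tnth P s) (m%:R * t - s%:R).

Definition closed_curve (B : R -> point) : Prop := B 0 = B 1.

Definition simple_curve (B : R -> point) : Prop :=
  forall s t : R, 0 <= s -> s < t -> t <= 1 -> B s = B t -> s = 0 /\ t = 1.

(* Derivative on [0, 1]: one-sided at the two end points. *)
Definition diff_quot (B : R -> point) (t u : R) : point :=
  (u - t)^-1 *: (B u - B t).

Definition derivable01 (B : R -> point) (t : R) : Prop :=
  cvg (diff_quot B t @ within `[0, 1] t^').

Definition derive01 (B : R -> point) (t : R) : point :=
  lim (diff_quot B t @ within `[0, 1] t^').

Definition C1_curve (B : R -> point) : Prop :=
  [/\ forall t : R, 0 <= t <= 1 -> derivable01 B t,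
      {within `[0, 1], continuous (derive01 B)}
    & closed_curve B -> derive01 B 0 = derive01 B 1].

Definition regular_curve (B : R -> point) : Prop :=
  forall t : R, 0 <= t <= 1 -> derive01 B t != 0.

(* de_casteljau q l j is the point q_j^l. *)
Fixpoint de_casteljau (q : seq point) (l j : nat) : point :=
  if l is l'.+1
  then 2^-1 *: (de_casteljau q l' j + de_casteljau q l' j.+1)
  else q`_j.

Definition subdivide n (q : n.+1.-tuple point) : seq (n.+1.-tuple point) :=
  [:: [tuple de_casteljau q l 0 | l < n.+1];
      [tuple de_casteljau q (n - j) j | j < n.+1]].

Definition subdivision n (i : nat) (P : seq (n.+1.-tuple point)) :
    seq (n.+1.-tuple point) :=
  iter i (fun Q => flatten (map (@subdivide n) Q)) P.

(* Vertices of the union of consecutive polygons; the first vertex of each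
   polygon but the first is dropped, being the last vertex of its predecessor. *)
Definition union_polygon n (P : seq (n.+1.-tuple point)) : seq point :=
  if P is q :: _ then thead q :: flatten [seq behead (val r) | r <- P]
  else [::].

(* Consecutive edges b - a and c - b of the PL curve with vertices v; a closed
   PL curve also has consecutive edges at its base point. *)
Definition consecutive_vertices (v : seq point) (a b c : point) : Prop :=
  (exists2 j : nat, (j.+2 < size v)%N & [/\ a = v`_j, b = v`_j.+1 & c = v`_j.+2])
  \/ [/\ (1 < size v)%N, v`_0 = v`_(size v).-1,
         a = v`_(size v).-2, b = v`_0 & c = v`_1].

Definition exterior_angle (v : seq point) (alpha : R) : Prop :=
  exists a b c : point,
    [/\ consecutive_vertices v a b c, b - a != 0, c - b != 0
      & alpha = angle (b - a) (c - b)].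

End Bezier.

(* Main.v *)
From HB Require Import structures.
Require Import Defs.
From mathcomp Require Import all_boot all_order all_algebra.
From mathcomp Require Import all_classical all_reals all_analysis.
From mathcomp Require Import ring lra zify.
Import Order.TTheory GRing.Theory Num.Theory.
Import numFieldNormedType.Exports.
Local Open Scope ring_scope.

Set Implicit Arguments.
Unset Strict Implicit.
Unset Printing Implicit Defensive.

(** Let K = m 2^i be the number of sub-polygons after i subdivisions. Three
    facts together bound the exterior angles.

    - Subdivision divides the second differences of a control polygon by 4: each
      second difference of a half is 1/4 of an average of second differences
      of the whole polygon ([bend_le_left_half], [bend_le_right_half]). So
      after i subdivisions consecutive edges inside a sub-polygon differ by at
      most M / 4^i.

    - The k-th sub-polygon parametrizes B over [k/K, (k+1)/K] ([subdivisionP]).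
      A Bezier curve of degree n leaves its first control point with velocity n
      times its first edge, so the first edge of every sub-polygon is
      B'(k/K) / (K n) ([derive01_first_edge]), and likewise its last edge is
      B'((k+1)/K) / (K n) ([derive01_last_edge]). As B is C1, the two edges
      meeting where two sub-polygons join, or at the base point of a closed
      curve, are therefore equal: the angle is 0 there.

    - As B' is continuous and never vanishes on [0, 1], it is bounded below by
      some c > 0 ([regular_lower_bound]). First edges have length at least
      c / (K n), of order 2^-i, and the other edges of a sub-polygon differ from
      the first one by O(4^-i), so for large i every edge has length at
      least c / (2 K n).

    Hence consecutive edges u, v satisfy |v - u| / |v| = O(2^-i), and the angle
    between them is at most twice this ratio once it is small ([angle_le]). The
    angles are thus O(2^-i), which is stronger than O(sqrt (2^-i)).

    The algebra of subdivision is done by letting polynomials act on control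
    polygons, 'X being the shift of indices ([shiftp]). Then the de Casteljau
    points are the values of ((1 + 'X) / 2)^l 'X^j, the Bezier curve is the
    value of ((1 - t) + t 'X)^n, and second differences are obtained by
    multiplying by ('X - 1)^2; the identities needed become identities between
    polynomials. *)

(** * Control polygons as modules over polynomials in the shift *)

Section ShiftCalculus.
Context {R : realType}.
Notation point := 'rV[R]_3.
Implicit Types (q : seq point) (p : {poly R}).

(** The value at index 0 of p(S) q, S being the shift of sequences; entries past
    the end of q count as 0, which is also the default value of [q`_i]. *)
Definition shiftp q p : point := \sum_(i < size q) p`_i *: q`_i.

Lemma shiftp_linear q : linear (shiftp q).
Proof.
move=> a p1 p2; rewrite /shiftp scaler_sumr -big_split /=.
by apply: eq_bigr => i _; rewrite coefD coefZ scalerDl scalerA.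
Qed.

HB.instance Definition _ q :=
  GRing.isLinear.Build R {poly R} point *:%R (shiftp q) (shiftp_linear q).

Lemma shiftpXn q j : shiftp q 'X^j = q`_j.
Proof.
rewrite /shiftp; have [ltj | lej] := ltnP j (size q).
  rewrite (bigD1 (Ordinal ltj)) //= coefXn eqxx scale1r big1 ?addr0 // => i.
  by rewrite -val_eqE /= => /negPf nij; rewrite coefXn nij scale0r.
rewrite nth_default // big1 // => i _; rewrite coefXn.
have [ij | _] := eqVneq (val i) j; last by rewrite scale0r.
by move: lej; rewrite -ij leqNgt ltn_ord.
Qed.

(** One de Casteljau step as a polynomial in the shift. *)
Definition midp : {poly R} := 2^-1 *: (1 + 'X).

Lemma de_casteljauE q l j : de_casteljau q l j = shiftp q (midp ^+ l * 'X^j).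
Proof.
elim: l j => [|l IHl] j /=; first by rewrite mul1r shiftpXn.
rewrite !IHl -linearD -linearZ; congr shiftp.
by rewrite exprSr exprS /midp -!mul_polyC; ring.
Qed.

(** Binomial expansion, for arbitrary polynomials x and y: the pair (1, 'X)
    gives a Bezier curve, (1, [midp]) its left half and ([midp], 'X) its right
    half. *)
Lemma bernstein_sum n (t : R) (x y : {poly R}) :
  \sum_(j < n.+1) ('C(n, j)%:R * t ^+ j * (1 - t) ^+ (n - j)) *:
     (x ^+ (n - j) * y ^+ j) = ((1 - t) *: x + t *: y) ^+ n.
Proof.
rewrite exprDn; apply: eq_bigr => j _.
rewrite -scaler_nat -!mul_polyC !polyCM !exprMn !polyC_exp.
by move: (n - j)%N => k; rewrite polyC_natr -mulr_natl; ring.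
Qed.

Lemma bezierE n (q : n.+1.-tuple point) t :
  bezier q t = shiftp q (((1 - t) *: 1 + t *: 'X) ^+ n).
Proof.
rewrite -bernstein_sum linear_sum; apply: eq_bigr => j _.
by rewrite linearZ /= expr1n mul1r shiftpXn (tnth_nth 0).
Qed.

Definition left_half n (q : n.+1.-tuple point) : n.+1.-tuple point :=
  [tuple de_casteljau q l 0 | l < n.+1].
Definition right_half n (q : n.+1.-tuple point) : n.+1.-tuple point :=
  [tuple de_casteljau q (n - j) j | j < n.+1].

Lemma nth_mktuple_ord n (f : 'I_n.+1 -> point) j (ltj : (j < n.+1)%N) :
  [tuple f l | l < n.+1]`_j = f (Ordinal ltj).
Proof. by rewrite -(tnth_nth _ _ (Ordinal ltj)) tnth_mktuple. Qed.

Lemma nth_left_half n (q : n.+1.-tuple point) j : (j <= n)%N ->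
  (left_half q)`_j = shiftp q (midp ^+ j).
Proof. by move=> lej; rewrite nth_mktuple_ord de_casteljauE mulr1. Qed.

Lemma nth_right_half n (q : n.+1.-tuple point) j : (j <= n)%N ->
  (right_half q)`_j = shiftp q (midp ^+ (n - j) * 'X^j).
Proof. by move=> lej; rewrite nth_mktuple_ord de_casteljauE. Qed.

(** (1 - t) + t (1 + 'X) / 2 = (1 - t / 2) + (t / 2) 'X. *)
Lemma bezier_left_half n (q : n.+1.-tuple point) t :
  bezier (left_half q) t = bezier q (t / 2).
Proof.
rewrite [RHS]bezierE.
have -> : (1 - t / 2) *: 1 + t / 2 *: 'X = (1 - t) *: 1 + t *: midp.
  by apply/polyP => i; rewrite !(coefD, coefN, coefZ, coef1, coefX); field.
rewrite -bernstein_sum linear_sum; apply: eq_bigr => j _.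
by rewrite linearZ /= (tnth_nth 0) nth_left_half ?expr1n ?mul1r // -ltnS.
Qed.

(** (1 - t) (1 + 'X) / 2 + t 'X = (1 - u) + u 'X with u = (1 + t) / 2. *)
Lemma bezier_right_half n (q : n.+1.-tuple point) t :
  bezier (right_half q) t = bezier q ((1 + t) / 2).
Proof.
rewrite [RHS]bezierE.
have -> : (1 - (1 + t) / 2) *: 1 + (1 + t) / 2 *: 'X
           = (1 - t) *: midp + t *: 'X.
  by apply/polyP => i; rewrite !(coefD, coefN, coefZ, coef1, coefX); field.
rewrite -bernstein_sum linear_sum; apply: eq_bigr => j _.
by rewrite linearZ /= (tnth_nth 0) nth_right_half // -ltnS.
Qed.

Definition bend_le n q (M : R) := forall j, (j.+2 <= n)%N ->
  `|(q`_j.+2 - q`_j.+1) - (q`_j.+1 - q`_j)| <= M.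

Lemma bend_shiftp q j :
  (q`_j.+2 - q`_j.+1) - (q`_j.+1 - q`_j) = shiftp q ('X^j * ('X - 1) ^+ 2).
Proof.
by rewrite -!shiftpXn -!linearB; congr shiftp; rewrite !exprS; ring.
Qed.

(** Applying [midp] averages two neighbouring second differences, and this
    cannot exceed a common bound. *)
Lemma bend_le_midp n q M l j : bend_le n q M -> (l + j.+2 <= n)%N ->
  `|shiftp q (midp ^+ l * 'X^j * ('X - 1) ^+ 2)| <= M.
Proof.
move=> qM; elim: l j => [|l IHl] j lej.
  by rewrite mul1r -bend_shiftp qM.
have -> : midp ^+ l.+1 * 'X^j * ('X - 1) ^+ 2 =
   2^-1 *: (midp ^+ l * 'X^j * ('X - 1) ^+ 2 +
            midp ^+ l * 'X^(j.+1) * ('X - 1) ^+ 2).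
  by rewrite !exprS {1}/midp -!mul_polyC; ring.
rewrite linearZ /= linearD /= normrZ ger0_norm ?invr_ge0 ?ler0n //.
have h1 := IHl j ltac:(lia); have h2 := IHl j.+1 ltac:(lia).
by have := ler_normD (shiftp q (midp ^+ l * 'X^j * ('X - 1) ^+ 2))
                 (shiftp q (midp ^+ l * 'X^(j.+1) * ('X - 1) ^+ 2)); lra.
Qed.

Lemma midp_sub1 : midp - 1 = 2^-1 *: ('X - 1).
Proof.
by apply/polyP => i; rewrite !(coefD, coefN, coefZ, coef1, coefX); field.
Qed.

Lemma sub_midp : 'X - midp = 2^-1 *: ('X - 1).
Proof.
by apply/polyP => i; rewrite !(coefD, coefN, coefZ, coef1, coefX); field.
Qed.

(** The factor 1/4 is the square of the 1/2 in [midp_sub1]: a first difference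
    along the left edge of the de Casteljau triangle is half an edge. *)
Lemma bend_le_left_half n (q : n.+1.-tuple point) M :
  bend_le n q M -> bend_le n (left_half q) (M / 4).
Proof.
move=> qM j lej; rewrite !nth_left_half; [|lia..].
rewrite -!linearB /=.
have -> : midp ^+ j.+2 - midp ^+ j.+1 - (midp ^+ j.+1 - midp ^+ j) =
    (2^-1 ^+ 2) *: (midp ^+ j * 'X^0 * ('X - 1) ^+ 2).
  by rewrite scalerAr -exprZn -midp_sub1 !exprS; ring.
rewrite linearZ /= normrZ ger0_norm ?exprn_ge0 ?invr_ge0 ?ler0n //.
by have := bend_le_midp (l := j) (j := 0) qM ltac:(lia); lra.
Qed.

(** Same as for the left half: the first differences along the right edge of the
    triangle are given by [sub_midp]. *)
Lemma bend_le_right_half n (q : n.+1.-tuple point) M :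
  bend_le n q M -> bend_le n (right_half q) (M / 4).
Proof.
move=> qM j lej; rewrite !nth_right_half; [|lia..].
have [l nE] : exists l, n = (l + j.+2)%N by exists (n - j.+2)%N; lia.
have -> : (n - j.+2 = l)%N by lia.
have -> : (n - j.+1 = l.+1)%N by lia.
have -> : (n - j = l.+2)%N by lia.
rewrite -!linearB /=.
have -> : midp ^+ l * 'X^(j.+2) - midp ^+ l.+1 * 'X^(j.+1) -
          (midp ^+ l.+1 * 'X^(j.+1) - midp ^+ l.+2 * 'X^j) =
    (2^-1 ^+ 2) *: (midp ^+ l * 'X^j * ('X - 1) ^+ 2).
  by rewrite scalerAr -exprZn -sub_midp !exprS; ring.
rewrite linearZ /= normrZ ger0_norm ?exprn_ge0 ?invr_ge0 ?ler0n //.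
by have := bend_le_midp (l := l) (j := j) qM ltac:(lia); lra.
Qed.

(** Expansion in powers of t, from (1 - t) + t 'X = 1 + t ('X - 1): the
    coefficients are multiples of the forward differences of q at 0. *)
Lemma bezier_taylor n (q : n.+1.-tuple point) t :
  bezier q t = \sum_(k < n.+1) t ^+ k *: (shiftp q (('X - 1) ^+ k) *+ 'C(n, k)).
Proof.
rewrite bezierE.
have -> : (1 - t) *: 1 + t *: 'X = 1 + t *: ('X - 1) :> {poly R}.
  by rewrite scalerBl scalerBr scale1r; ring.
rewrite exprDn linear_sum; apply: eq_bigr => k _.
by rewrite expr1n mul1r exprZn linearMn linearZ /= scalerMnr.
Qed.

End ShiftCalculus.

(** * Angles between nearby vectors *)

Section Angle.
Context {R : realType}.
Notation point := 'rV[R]_3.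
Implicit Types u v : point.

(** By the mean value theorem the angle a satisfies sin a = a cos c for some
    c <= a, and cos c >= cos a = x >= 1/2. *)
Lemma acos_le_sqrt (x : R) : 2^-1 <= x -> x <= 1 ->
  acos x <= 2 * Num.sqrt (1 - x ^+ 2).
Proof.
move=> x_ge x_le.
have xI : -1 <= x <= 1 by lra.
rewrite -(sin_acos xI); set a := acos x.
have a_ge0 : 0 <= a by apply: acos_ge0.
have a_lepi : a <= pi by apply: acos_lepi.
have cosa : cos a = x by rewrite acosK // in_itv.
have [c] : exists2 c, c \in `[0, a] & sin a - sin 0 = cos c * (a - 0).
  apply: (@MVT_segment _ sin cos) => //.
  by apply: continuous_subspaceT; exact: continuous_sin.
rewrite in_itv /= sin0 !subr0 => /andP[c_ge0 lec] ->.
have : x <= cos c.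
  rewrite -cosa leNgt ltr_cos ?in_itv /= ?a_ge0 ?c_ge0 //; last lra.
  by rewrite -leNgt.
by nra.
Qed.

Lemma dotE u v : dot u v = u 0 0 * v 0 0 + u 0 1 * v 0 1 + u 0 2%:R * v 0 2%:R.
Proof.
rewrite /dot !big_ord_recl big_ord0 addr0 !addrA.
by congr (_ * _ + _ * _ + _ * _); congr (_ _ _); apply/val_inj.
Qed.

Lemma dot_ge0 u : 0 <= dot u u.
Proof. by rewrite dotE -!expr2 !addr_ge0 ?sqr_ge0. Qed.

(** Lagrange's identity: the defect is the squared norm of the cross product. *)
Lemma dot_cauchy_schwarz u v : dot u v ^+ 2 <= dot u u * dot v v.
Proof.
rewrite !dotE.
set a := u 0 0; set b := u 0 1; set c := u 0 2%:R.
set d := v 0 0; set e := v 0 1; set f := v 0 2%:R.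
have := sqr_ge0 (a * e - b * d); have := sqr_ge0 (a * f - c * d).
have := sqr_ge0 (b * f - c * e); nra.
Qed.

Lemma dot_subE u v : dot (v - u) (v - u) = dot u u + dot v v - 2 * dot u v.
Proof. by rewrite !dotE !mxE; ring. Qed.

Lemma norm_le_enorm u : `|u| <= enorm u.
Proof.
have [->|] := eqVneq `|u| 0; first exact: sqrtr_ge0.
move=> /mx_norm_neq0[[i j] /= uE].
rewrite {1}/Num.norm /= uE -sqrtr_sqr ler_wsqrtr // /dot (bigD1 j) //= (ord1 i).
by rewrite -expr2 lerDl sumr_ge0 // => k _; rewrite -expr2 sqr_ge0.
Qed.

Lemma enorm_le_norm u : enorm u <= 2 * `|u|.
Proof.
have le_coord j : u ord0 j * u ord0 j <= `|u| ^+ 2.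
  rewrite -expr2 -real_normK ?num_real // ler_pXn2r ?nnegrE //.
  rewrite {2}/Num.norm /= mx_normrE.
  exact: (le_bigmax _ (fun ij : 'I_1 * 'I_3 => `|u ij.1 ij.2|) (ord0, j)).
rewrite -(ger0_norm (_ : 0 <= 2 * `|u|)) ?mulr_ge0 //.
rewrite -sqrtr_sqr ler_wsqrtr //.
apply: (@le_trans _ _ (\sum_(j < 3) `|u| ^+ 2)); first exact: ler_sum.
by rewrite sumr_const card_ord; have := sqr_ge0 `|u|; rewrite -mulr_natl; nra.
Qed.

(** With a = |u|, b = |v|, d = |v - u| and p = u.v, the bound
    sin^2 <= (d / b)^2 amounts to 0 <= (a^2 - p)^2 after substituting
    d^2 = a^2 + b^2 - 2 p. The hypothesis forces the cosine to be at least 1/2,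
    where the angle is at most twice its sine. *)
Lemma angle_le u v : u != 0 -> v != 0 -> 2 * enorm (v - u) <= enorm v ->
  angle u v <= 2 * (enorm (v - u) / enorm v).
Proof.
have enorm_gt0 (w : point) : w != 0 -> 0 < enorm w.
  by move=> w0; apply: lt_le_trans (norm_le_enorm w); rewrite normr_gt0.
move=> /enorm_gt0 a_gt0 /enorm_gt0 b_gt0 small.
have sqE (w : point) : enorm w ^+ 2 = dot w w by rewrite sqr_sqrtr ?dot_ge0.
have := dot_cauchy_schwarz u v; have := dot_subE u v.
rewrite /angle -!sqE.
move: (sqrtr_ge0 _ : 0 <= enorm (v - u)) a_gt0 b_gt0 small.
move: (enorm u) (enorm v) (enorm (v - u)) (dot u v) => a b d p.
move=> d_ge0 a_gt0 b_gt0 small dE cs.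
have ab_gt0 : 0 < a * b by nra.
have p_ge : 2^-1 <= p / (a * b).
  have : (2 * d) ^+ 2 <= b ^+ 2 by rewrite ler_pXn2r ?nnegrE //; lra.
  by have := sqr_ge0 (a - b / 2); rewrite ler_pdivlMr // => ? ?; nra.
have p_le : p / (a * b) <= 1.
  rewrite ler_pdivrMr // mul1r leNgt; apply/negP => ltp.
  have : 0 < (p - a * b) * (p + a * b) by apply: mulr_gt0; lra.
  by lra.
apply: le_trans (acos_le_sqrt p_ge p_le) _; rewrite ler_wpM2l //.
have db_ge0 : 0 <= d / b by rewrite divr_ge0 // ltW.
rewrite -(ger0_norm db_ge0) -sqrtr_sqr ler_wsqrtr //.
have -> : 1 - (p / (a * b)) ^+ 2 = ((a * b) ^+ 2 - p ^+ 2) / (a * b) ^+ 2.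
  by field; lra.
have -> : (d / b) ^+ 2 = a ^+ 2 * d ^+ 2 / (a * b) ^+ 2 by field; lra.
rewrite ler_pM2r ?invr_gt0 ?exprn_gt0 // dE.
by have := sqr_ge0 (a ^+ 2 - p); nra.
Qed.

End Angle.

(** * The derivative of a curve at the ends of a Bezier piece *)

Section Derivative.
Local Open Scope classical_set_scope.
Context {R : realType}.
Notation point := 'rV[R]_3.

Lemma bezier0 n (q : n.+1.-tuple point) : bezier q 0 = q`_0.
Proof.
rewrite bezier_taylor big_ord_recl big1 => [|k _]; last first.
  by rewrite exprS mul0r scale0r.
by rewrite addr0 expr0 scale1r bin0 mulr1n -(shiftpXn q 0).
Qed.

Lemma bezier_rev n (q : n.+1.-tuple point) t :
  bezier [tuple of rev q] t = bezier q (1 - t).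
Proof.
rewrite /bezier [RHS](reindex_inj rev_ord_inj) /=; apply: eq_bigr => j _.
have lej : (j <= n)%N by rewrite -ltnS.
rewrite !(tnth_nth 0) /= nth_rev ?size_tuple // subSS bin_sub // subKn //.
by rewrite subKr; congr (_ *: _); ring.
Qed.

(** By [bezier_taylor] the quotient is a polynomial in t with constant term
    n ('X - 1) applied to q. *)
Lemma bezier_quot_cvg n (q : n.+1.-tuple point) : (0 < n)%N ->
  t^-1 *: (bezier q t - bezier q 0) @[t --> 0^'+] --> n%:R *: (q`_1 - q`_0).
Proof.
case: n q => // n q _.
pose w k : point := shiftp q (('X - 1) ^+ k) *+ 'C(n.+1, k).
have -> : n.+1%:R *: (q`_1 - q`_0) = \sum_(k < n.+1) 0 ^+ k *: w k.+1.
  rewrite big_ord_recl big1 => [|k _]; last by rewrite exprS mul0r scale0r.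
  rewrite addr0 scale1r /w bin1 expr1 scaler_nat.
  by rewrite -(shiftpXn q 1) -(shiftpXn q 0) -linearB.
have gE : {near 0^'+, (fun t : R => \sum_(k < n.+1) t ^+ k *: w k.+1) =1
                      (fun t : R => t^-1 *: (bezier q t - bezier q 0))}.
  near=> t; have t_gt0 : 0 < t by near: t; exact: nbhs_right_gt.
  rewrite bezier0 bezier_taylor [in RHS]big_ord_recl scale1r bin0 mulr1n.
  rewrite -(shiftpXn q 0) addrAC subrr add0r scaler_sumr.
  apply: eq_bigr => k _; rewrite scalerA exprS mulKf ?gt_eqF //.
apply: cvg_trans (near_eq_cvg gE) _.
apply: cvg_at_right_filter; apply: cvg_big => [|k _].
  exact: add_continuous.
apply: cvgZr_tmp; exact: exprn_continuous.
Unshelve. all: by end_near. Qed.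

(** The derivative of B at t0 can be read off from any Bezier piece of B that
    starts at t0; the speed s is negative for a piece traversed backwards, which
    covers the end points of pieces too. *)
Lemma derive01_bezier n (q : n.+1.-tuple point) (B : R -> point) (t0 s : R) :
  (0 < n)%N -> s != 0 -> derivable01 B t0 ->
  (forall t : R, 0 <= t <= 1 -> 0 <= t0 + s * t <= 1) ->
  (forall t : R, 0 <= t <= 1 -> B (t0 + s * t) = bezier q t) ->
  derive01 B t0 = s^-1 *: (n%:R *: (q`_1 - q`_0)).
Proof.
move=> n_gt0 s_neq0 dB in01 BE.
have reparam : t0 + s * t @[t --> 0^'+] `=>` within `[0, 1] t0^'.
  move=> A nA.
  have cont : t0 + s * t @[t --> 0^'+] --> t0 + s * 0.
    apply: cvg_at_right_filter; apply: cvgD; first exact: cvg_cst.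
    by apply: cvgM; [exact: cvg_cst | exact: cvg_id].
  rewrite mulr0 addr0 in cont.
  change (\forall t \near 0^'+, A (t0 + s * t)).
  near=> t.
  have t_gt0 : 0 < t by near: t; exact: nbhs_right_gt.
  have t_lt1 : t < 1 by near: t; exact: nbhs_right_lt.
  have At : (t0 + s * t) != t0 -> `[0, 1] (t0 + s * t) -> A (t0 + s * t).
    near: t; exact: cont nA.
  apply: At; last by rewrite /= in_itv /= in01 // !ltW.
  by rewrite -subr_eq0 addrAC subrr add0r mulf_neq0 // gt_eqF.
pose g t := diff_quot B t0 (t0 + s * t).
have lim1 : g t @[t --> 0^'+] --> derive01 B t0 := cvg_comp _ _ reparam dB.
suff lim2 : g t @[t --> 0^'+] --> s^-1 *: (n%:R *: (q`_1 - q`_0)).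
  by apply: (cvg_unique _ lim1 lim2); exact: norm_hausdorff.
apply: cvg_trans (cvgZl_tmp (k := s^-1) (bezier_quot_cvg (q := q) n_gt0)).
apply: near_eq_cvg; near=> t.
have t_gt0 : 0 < t by near: t; exact: nbhs_right_gt.
have t_lt1 : t < 1 by near: t; exact: nbhs_right_lt.
have B0 : B t0 = bezier q 0 by rewrite -BE ?lexx ?ler01 // mulr0 addr0.
have tI : 0 <= t <= 1 by rewrite !ltW.
rewrite /g /diff_quot BE //.
rewrite B0 /GRing.scale_fun /= scalerA; congr (_ *: _).
by rewrite addrAC subrr add0r invfM.
Unshelve. all: by end_near. Qed.

End Derivative.

(** * Iterated subdivision of a composite curve *)

Section Subdivision.
Context {R : realType} {n : nat}.
Notation point := 'rV[R]_3.
Notation polygon := (n.+1.-tuple point).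
Implicit Types (Q : seq polygon) (B : R -> point).

Definition polygon0 : polygon := [tuple of nseq n.+1 0].

(** The form of [composite_bezier] that subdivision preserves: it concerns plain
    sequences, and each piece is parametrized by [0, 1]. *)
Definition traces Q B := forall k (t : R), (k < size Q)%N -> 0 <= t <= 1 ->
  B ((k%:R + t) / (size Q)%:R) = bezier (nth polygon0 Q k) t.

Lemma size_flatten_subdivide Q :
  size (flatten (map (@subdivide R n) Q)) = (size Q).*2.
Proof. by elim: Q => //= q Q IHQ; rewrite IHQ doubleS. Qed.

Lemma nth_flatten_subdivide Q k (b : bool) : (k < size Q)%N ->
  nth polygon0 (flatten (map (@subdivide R n) Q)) (b + k.*2) =
    (if b then @right_half R n else @left_half R n) (nth polygon0 Q k).
Proof.
elim: Q k => // q Q IHQ [|k] /=; first by case: (b).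
by rewrite ltnS => /IHQ <-; rewrite doubleS !addnS.
Qed.

(** Piece number k after subdivision is a half of piece [k./2], the right one
    exactly when k is odd. *)
Lemma traces_subdivide Q B :
  traces Q B -> traces (flatten (map (@subdivide R n) Q)) B.
Proof.
move=> QB k t; rewrite size_flatten_subdivide => ltk tI.
rewrite -(odd_double_half k) nth_flatten_subdivide; last by lia.
have ltk2 : (k./2 < size Q)%N by lia.
have s_neq0 : (size Q)%:R != 0 :> R by rewrite pnatr_eq0; lia.
have halfI : 0 <= ((odd k)%:R + t) / 2 <= 1.
  by case: (odd k) => /=; lra.
transitivity (bezier (nth polygon0 Q k./2) (((odd k)%:R + t) / 2)); last first.
  by case: (odd k); rewrite ?bezier_right_half // bezier_left_half add0r.
rewrite -QB //; congr B.
by rewrite -!muln2 natrD !natrM; field.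
Qed.

Lemma subdivisionP i Q B M : traces Q B ->
  {in Q, forall q : polygon, bend_le n q M} ->
  [/\ size (subdivision i Q) = (size Q * 2 ^ i)%N, traces (subdivision i Q) B
    & {in subdivision i Q, forall q : polygon, bend_le n q (M / 4 ^+ i)}].
Proof.
move=> QB QM; elim: i => [|i [IHs IHt IHb]].
  by rewrite muln1 divr1.
split; first by rewrite /= size_flatten_subdivide IHs expnS -muln2; lia.
  exact: traces_subdivide.
move=> q /flatten_mapP[p pQ].
rewrite exprSr invfM mulrA !inE.
case/orP => /eqP->; [apply: bend_le_left_half | apply: bend_le_right_half];
  exact: IHb.
Qed.

Lemma bend_bounded Q :
  exists2 M : R, 0 <= M & {in Q, forall q : polygon, bend_le n q M}.
Proof.
exists (\sum_(q <- Q) \sum_(j < n) `|(q`_j.+2 - q`_j.+1) - (q`_j.+1 - q`_j)|).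
  by apply: sumr_ge0 => q _; apply: sumr_ge0 => j _.
move=> q qQ j lej; rewrite (big_rem q) //=.
have ltj : (j < n)%N by lia.
rewrite (bigD1 (Ordinal ltj)) //= -[leRHS]addrA lerDl addr_ge0 //.
  by apply: sumr_ge0.
by apply: sumr_ge0 => p _; apply: sumr_ge0.
Qed.

Lemma composite_traces m (P : m.-tuple polygon) B :
  composite_bezier P B -> traces P B.
Proof.
move=> PB k t; rewrite size_tuple => ltk tI.
have m_gt0 : 0 < m%:R :> R by rewrite ltr0n; lia.
rewrite (PB (Ordinal ltk)) /=.
  rewrite (tnth_nth polygon0); by congr bezier; field; lra.
by rewrite !ler_pM2r ?invr_gt0 // -natr1; lra.
Qed.

Lemma bezier1 (q : polygon) : bezier q 1 = q`_n.
Proof.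
rewrite -[1 in LHS]subr0 -bezier_rev bezier0 /= nth_rev ?size_tuple //.
by rewrite subn1.
Qed.

Lemma size_union_polygon Q : (0 < size Q)%N ->
  size (union_polygon Q) = (size Q * n).+1.
Proof.
case: Q => // q0 Q _; rewrite /union_polygon; move: (q0 :: Q) => {q0}Q /=.
congr _.+1; elim: Q => //= q Q IHQ.
by rewrite size_cat IHQ size_behead size_tuple mulSn.
Qed.

(** Also true for r = 0, although [union_polygon] then lists the vertex as the
    last one of the preceding polygon: this is where [joint] is used. *)
Lemma nth_union_polygon Q k r : (0 < n)%N ->
  (forall l, (l.+1 < size Q)%N ->
     (nth polygon0 Q l)`_n = (nth polygon0 Q l.+1)`_0) ->
  (k < size Q)%N -> (r <= n)%N ->
  (union_polygon Q)`_(k * n + r) = (nth polygon0 Q k)`_r.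
Proof.
move=> n_gt0 joint.
have nth_tails l s : (l < size Q)%N -> (s < n)%N ->
    (flatten [seq behead (val q) | q <- Q])`_(l * n + s) =
    (nth polygon0 Q l)`_s.+1.
  elim: Q l {joint} => // q Q IHQ [|l] /= ltl lts;
    rewrite nth_cat size_behead size_tuple /=.
    by rewrite lts nth_behead.
  by rewrite ifF ?mulSn -?addnA ?addKn ?IHQ //; lia.
have unionE : union_polygon Q =
    (nth polygon0 Q 0)`_0 :: flatten [seq behead (val q) | q <- Q] \/ Q = [::].
  by case: (Q) => [|q Q']; [right | left; rewrite /= /thead (tnth_nth 0)].
case: unionE => [->|->] //.
case: r => [|r] ltk ler; last by rewrite addnS /= nth_tails.
rewrite addn0; case: k ltk => [|k] ltk //.
rewrite -joint //; have -> : (k.+1 * n = (k * n + n.-1).+1)%N by lia.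
by rewrite /= nth_tails; [rewrite prednK | lia | lia].
Qed.

End Subdivision.

(** * Edges of the subdivided control polygon *)

Section Edges.
Context {R : realType} {n : nat}.
Notation point := 'rV[R]_3.
Notation polygon := (n.+1.-tuple point).
Implicit Types (Q : seq polygon) (B : R -> point).

Lemma traces_joint Q B k : traces Q B -> (k.+1 < size Q)%N ->
  (nth (@polygon0 R n) Q k)`_n = (nth (@polygon0 R n) Q k.+1)`_0.
Proof.
move=> QB ltk; rewrite -bezier1 -bezier0.
rewrite -(QB k) ?(ltnW ltk) ?lexx ?ler01 // -(QB k.+1) ?lexx ?ler01 //.
by congr B; rewrite addr0 -natr1.
Qed.

Lemma derive01_first_edge Q B k : (0 < n)%N -> traces Q B -> C1_curve B ->
  (k < size Q)%N -> let q := nth (@polygon0 R n) Q k in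
  derive01 B (k%:R / (size Q)%:R) = ((size Q)%:R * n%:R) *: (q`_1 - q`_0).
Proof.
move=> n_gt0 QB [dB _ _] ltk q.
have K_gt0 : 0 < (size Q)%:R :> R by rewrite ltr0n; lia.
have lek : k%:R + 1 <= (size Q)%:R :> R by rewrite natr1 ler_nat.
have k_ge0 : 0 <= k%:R :> R by [].
have in01 (t : R) : 0 <= t <= 1 ->
    0 <= k%:R / (size Q)%:R + (size Q)%:R^-1 * t <= 1.
  move=> tI; rewrite [_^-1 * t]mulrC -mulrDl.
  by rewrite ler_pdivlMr // ler_pdivrMr // mul0r mul1r; lra.
rewrite (derive01_bezier (q := q) (s := (size Q)%:R^-1) n_gt0) //.
- by rewrite invrK scalerA.
- by rewrite invr_neq0 // gt_eqF.
- by apply: dB; have := in01 0; rewrite mulr0 addr0; apply; rewrite lexx ler01.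
- by move=> t tI; rewrite -QB // [_^-1 * t]mulrC -mulrDl.
Qed.

(** The last edge is the first edge of the reversed polygon, which traces B
    backwards from (k + 1) / K. *)
Lemma derive01_last_edge Q B k : (0 < n)%N -> traces Q B -> C1_curve B ->
  (k < size Q)%N -> let q := nth (@polygon0 R n) Q k in
  derive01 B (k.+1%:R / (size Q)%:R) = ((size Q)%:R * n%:R) *: (q`_n - q`_n.-1).
Proof.
move=> n_gt0 QB [dB _ _] ltk q.
have K_gt0 : 0 < (size Q)%:R :> R by rewrite ltr0n; lia.
have lek : k%:R + 1 <= (size Q)%:R :> R by rewrite natr1 ler_nat.
have k_ge0 : 0 <= k%:R :> R by [].
have lineE (t : R) : k.+1%:R / (size Q)%:R + - (size Q)%:R^-1 * t
    = (k%:R + (1 - t)) / (size Q)%:R.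
  by rewrite mulNr [_^-1 * t]mulrC -mulrBl -natr1 addrA.
have in01 (t : R) : 0 <= t <= 1 ->
    0 <= k.+1%:R / (size Q)%:R + - (size Q)%:R^-1 * t <= 1.
  move=> tI; rewrite lineE.
  by rewrite ler_pdivlMr // ler_pdivrMr // mul0r mul1r; lra.
rewrite (derive01_bezier (q := [tuple of rev q])
                        (s := - (size Q)%:R^-1) n_gt0) //.
- rewrite /= !nth_rev ?size_tuple // subn1 subn2 /= -invrN invrK scalerA mulNr.
  by rewrite scaleNr -scalerN opprB.
- by rewrite oppr_eq0 invr_neq0 // gt_eqF.
- by apply: dB; have := in01 0; rewrite mulr0 addr0; apply; rewrite lexx ler01.
- by move=> t tI; rewrite bezier_rev lineE QB //; lra.
Qed.

(** Consecutive edges differ by at most eps, so the j-th one differs from the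
    first by at most j eps. *)
Lemma edge_ge (q : seq point) (eps : R) j : (j < n)%N -> bend_le n q eps ->
  `|q`_1 - q`_0| - j%:R * eps <= `|q`_j.+1 - q`_j|.
Proof.
move=> ltj qb; elim: j ltj => [|j IHj] ltj; first by rewrite mul0r subr0.
apply: le_trans (_ : `|q`_j.+1 - q`_j| - eps <= _).
  by have := IHj (ltnW ltj); rewrite -natr1; lra.
have := qb j ltj; rewrite distrC => le_eps.
have := ler_normD (q`_j.+2 - q`_j.+1) ((q`_j.+1 - q`_j) - (q`_j.+2 - q`_j.+1)).
by rewrite addrC subrK; lra.
Qed.

(** Consecutive edges either lie in one sub-polygon, where their difference is a
    second difference, or are the last edge of a sub-polygon and the first edge
    of the next one (cyclically, for a closed curve); the latter are both
    B' / (K n) at the same point, hence equal. *)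
Lemma consecutive_edges Q B eps a b c : (0 < n)%N -> (0 < size Q)%N ->
  0 <= eps -> traces Q B -> C1_curve B ->
  {in Q, forall q : polygon, bend_le n q eps} ->
  consecutive_vertices (union_polygon Q) a b c ->
  `|(c - b) - (b - a)| <= eps /\
  exists k j, [/\ (k < size Q)%N, (j < n)%N
    & c - b = (nth (@polygon0 R n) Q k)`_j.+1 -
              (nth (@polygon0 R n) Q k)`_j].
Proof.
move=> n_gt0 Q_gt0 eps_ge0 QB C1 Qb.
have K_neq0 : (size Q)%:R != 0 :> R by rewrite pnatr_eq0; lia.
have Kn_neq0 : (size Q)%:R * n%:R != 0 :> R.
  by rewrite mulf_neq0 // pnatr_eq0; lia.
have vE k r := nth_union_polygon (k := k) (r := r) n_gt0
  (fun l => traces_joint (k := l) QB).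
have sizeE := size_union_polygon Q_gt0.
case=> [[J]|[_]]; rewrite sizeE.
- move=> ltJ [-> -> ->].
  pose k := (J %/ n)%N; pose r := (J %% n)%N.
  have JE : J = (k * n + r)%N by exact: divn_eq.
  have ltr : (r < n)%N by rewrite ltn_mod.
  have ltk : (k < size Q)%N by rewrite ltn_divLR //; lia.
  (* J = k n + r is the r-th edge of the k-th sub-polygon. *)
  have [ltr1 | ler1] := ltnP r.+1 n.
    rewrite JE -!addnS !vE //; [|lia..].
    by split; [apply: Qb; rewrite ?mem_nth | exists k, r.+1].
  have {ltr ler1} rE : r = n.-1 by lia.
  have ltk1 : (k.+1 < size Q)%N by nia.
  have e1 : J.+1 = (k.+1 * n + 0)%N by lia.
  have e2 : J.+2 = (k.+1 * n + 1)%N by lia.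
  rewrite e2 e1 JE !vE //; [|lia..].
  have := derive01_first_edge n_gt0 QB C1 ltk1.
  rewrite (derive01_last_edge n_gt0 QB C1 ltk) => /(scalerI Kn_neq0) /=.
  rewrite rE -(traces_joint QB ltk1) => ->.
  rewrite subrr normr0; split=> //; exists k.+1, 0%N.
  by rewrite -(traces_joint QB ltk1).
(* The base point of a closed polygon: the incoming edge ends the last
   sub-polygon, the outgoing one starts the first. *)
have [K' K'E] : exists K', size Q = K'.+1 by exists (size Q).-1; lia.
have ltK' : (K' < size Q)%N by lia.
have e0 : 0%N = (0 * n + 0)%N by [].
have e1 : 1%N = (0 * n + 1)%N by [].
have e2 : (size Q * n).+1.-1 = (K' * n + n)%N by rewrite K'E; lia.
have e3 : (size Q * n).+1.-2 = (K' * n + n.-1)%N by rewrite K'E; lia.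
rewrite e3 e2 [X in _`_X = _]e0 !vE // => [closedv -> -> ->|]; last by lia.
have [ltn1 lt0K] : (n.-1 <= n)%N /\ (0 < size Q)%N by lia.
have v1 : (union_polygon Q)`_1 = (nth (@polygon0 R n) Q 0)`_1.
  by rewrite [X in _`_X = _]e1 vE.
rewrite v1 => //.
have closedB : closed_curve B.
  have := closedv; rewrite -bezier0 -bezier1.
  rewrite -(QB 0%N) ?lexx ?ler01 // -(QB K') ?lexx ?ler01 //.
  by rewrite add0r mul0r natr1 -K'E divff.
have [_ _ /(_ closedB)] := C1.
rewrite -[X in derive01 B X = _](mul0r (size Q)%:R^-1).
rewrite -[X in _ = derive01 B X](divff K_neq0) [X in X%:R / _]K'E.
rewrite (derive01_first_edge n_gt0 QB C1 lt0K).
rewrite (derive01_last_edge n_gt0 QB C1 ltK').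
move=> /(scalerI Kn_neq0) /= edgeE.
rewrite edgeE closedv subrr normr0; split=> //.
by exists 0%N, 0%N; rewrite edgeE.
Qed.

Lemma regular_lower_bound B : regular_curve B -> C1_curve B ->
  exists2 c : R, 0 < c & forall t : R, 0 <= t <= 1 -> c <= `|derive01 B t|.
Proof.
move=> reg [_ cont _].
have [|t tI tmin] := @EVT_min _ (fun t => `|derive01 B t|) 0 1 ler01.
  apply: (@within_continuous_comp _ _ _ _ (derive01 B) Num.norm) => //.
  by move=> x _; exact: norm_continuous.
exists `|derive01 B t|; first by rewrite normr_gt0 reg // -in_itv.
by move=> u uI; apply: tmin; rewrite in_itv.
Qed.

End Edges.

Theorem theorem4p1 (R : realType) (m n : nat) (hm : (1 <= m)%N) (hn : (1 <= n)%N)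
    (P : m.-tuple (n.+1.-tuple 'rV[R]_3)) (B : R -> 'rV[R]_3)
    (hB : composite_bezier P B)
    (hsimple : simple_curve B) (hregular : regular_curve B) (hC1 : C1_curve B) :
  exists (C : R) (i0 : nat), 0 < C /\
    forall i : nat, (i0 <= i)%N ->
    forall alpha : R, exterior_angle (union_polygon (subdivision i P)) alpha ->
      alpha <= C * Num.sqrt (1 / 2 ^+ i).
Proof.
have [c c_gt0 le_c] := regular_lower_bound hregular hC1.
have [M M_ge0 bendM] := bend_bounded P.
have m_gt0 : 0 < m%:R :> R by rewrite ltr0n.
have n_gt0 : 0 < n%:R :> R by rewrite ltr0n.
(* D / 2^i is the bound on angles reached below: 8 eps / lb, where eps = M / 4^i
   bounds the turns from above and lb = c / (m 2^i n) the first edges from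
   below. *)
pose D : R := 8 * m%:R * n%:R * M / c.
have D_ge0 : 0 <= D by rewrite /D divr_ge0 ?mulr_ge0 // ltW.
(* Makes 8 (n + 4) eps <= lb, hence both n eps <= lb / 2, which keeps all edges
   above lb / 2, and 8 eps <= lb, the smallness required by [angle_le]. *)
pose i0 := (Num.trunc ((n%:R + 4) * D)).+1.
exists (D + 1), i0; split=> [|i le_i alpha]; first lra.
case=> a [b [d [abd ab bd ->]]].
have [sizeQ traceQ bendQ] := subdivisionP i (composite_traces hB) bendM.
move: (subdivision i P) sizeQ traceQ bendQ abd => Q sizeQ traceQ bendQ abd.
rewrite size_tuple in sizeQ.
have Q_gt0 : (0 < size Q)%N by rewrite sizeQ muln_gt0 hm expn_gt0.
set E : R := 2 ^+ i.
have E_gt0 : 0 < E by rewrite exprn_gt0.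
have E_large : (n%:R + 4) * D <= E.
  apply: (@le_trans _ _ i%:R).
    by apply: ltW; apply: lt_le_trans (truncnS_gt _) _; rewrite ler_nat.
  by rewrite /E -natrX ler_nat ltnW // ltn_expl.
have KE : (size Q)%:R = m%:R * E by rewrite sizeQ natrM natrX.
have epsE : M / 4 ^+ i = M / E ^+ 2.
  by rewrite /E exprAC; congr (_ / _ ^+ _); ring.
rewrite epsE in bendQ; set eps := M / E ^+ 2 in bendQ.
have eps_ge0 : 0 <= eps by rewrite divr_ge0 ?exprn_ge0 // ltW.
have [turn [k [j [ltk ltj edgeE]]]] :=
  consecutive_edges hn Q_gt0 eps_ge0 traceQ hC1 bendQ abd.
pose lb : R := c / (m%:R * E * n%:R).
have lb_gt0 : 0 < lb by rewrite divr_gt0 // !mulr_gt0.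
have epsD : 8 * eps = D * lb / E by rewrite /eps /lb /D; field; rewrite !gt_eqF.
have eps_small : 8 * (n%:R + 4) * eps <= lb.
  by rewrite mulrAC epsD mulrAC ler_pdivrMr //; nra.
have first_ge :
    lb <= `|(nth (@polygon0 R n) Q k)`_1 - (nth (@polygon0 R n) Q k)`_0|.
  have K_gt0 : 0 < (size Q)%:R :> R by rewrite ltr0n.
  have := le_c (k%:R / (size Q)%:R).
  rewrite ler_pdivlMr // ler_pdivrMr // mul0r mul1r ler_nat ler0n (ltnW ltk).
  move=> /(_ isT); rewrite (derive01_first_edge hn traceQ hC1 ltk) normrZ.
  rewrite ger0_norm ?mulr_ge0 // KE mulrC => le_edge.
  by rewrite /lb ler_pdivrMr // !mulr_gt0.
have edge_lb : lb / 2 <= `|d - b|.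
  rewrite edgeE.
  have := edge_ge ltj (bendQ _ (mem_nth (@polygon0 R n) ltk)).
  have jn : j%:R <= n%:R :> R by rewrite ler_nat ltnW.
  by nra.
(* The estimates so far are in the sup norm, angles need the Euclidean one. *)
have turn_le := enorm_le_norm ((d - b) - (b - a)).
have edge_le := norm_le_enorm (d - b).
have n_ge0 := ltW n_gt0.
have neps_ge0 := mulr_ge0 n_ge0 eps_ge0.
apply: le_trans (angle_le ab bd _) _; first lra.
have den_gt0 : 0 < enorm (d - b) by lra.
apply: (@le_trans _ _ (D / E)).
  have : D / E * (lb / 2) <= D / E * enorm (d - b).
    apply: ler_wpM2l; first exact: divr_ge0 D_ge0 (ltW E_gt0).
    exact: le_trans edge_lb edge_le.
  have -> : D / E * (lb / 2) = 4 * eps.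
    have -> : D / E * (lb / 2) = (D * lb / E) / 2 by ring.
    by rewrite -epsD; field.
  by rewrite mulrA ler_pdivrMr //; lra.
(* 1 / 2^i <= sqrt (1 / 2^i), as 2^i >= 1. *)
have E_ge1 : 1 <= E by rewrite exprn_ege1 // ler1n.
set x := 1 / E.
have x_ge0 : 0 <= x by rewrite divr_ge0 // ltW.
have x_le1 : x <= 1 by rewrite ler_pdivrMr // mul1r.
have := sqr_sqrtr x_ge0; have := sqrtr_ge0 x; set s := Num.sqrt x => s_ge0 sE.
have s_le1 : s <= 1 by rewrite -sqrtr1 ler_wsqrtr.
have -> : D / E = D * x by rewrite /x mul1r.
have s_compl : 0 <= 1 - s by lra.
have := mulr_ge0 (mulr_ge0 D_ge0 s_ge0) s_compl.
by rewrite -sE; lra.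
Qed.
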